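(* For every truncated path algebra $\Lambda$, the category $\mathcal{P}^{<\infty}(\Lambda\text{-mod})$ is contravariantly finite in $\Lambda\text{-mod}$, and for $1\le i\le n$ the canonical epimorphism $\mathcal{A}_i=\Lambda e_i/\varepsilon Je_i\to S_i$ is a minimal right $\mathcal{P}^{<\infty}(\Lambda\text{-mod})$-approximation of $S_i$. In particular, the minimal $\mathcal{P}^{<\infty}(\Lambda\text{-mod})$-approximations of the simple modules are local, hence indecomposable.
   Context: Let $K$ be a field, $Q$ a finite quiver with vertices $e_1,\dots,e_n$, $L\ge1$, and $\Lambda=KQ/I$ the truncated path algebra, $I$ generated by all paths of length $L+1$; $J$ is its Jacobson radical, $S_i=\Lambda e_i/Je_i$. A vertex $e_i$ is precyclic if some path (possibly of length $0$) starting at $e_i$ ends at a vertex on an oriented cycle of $Q$; $\varepsilon$ is the sum of the $e_i$ over non-precyclic vertices. $\mathcal{P}^{<\infty}(\Lambda\text{-mod})$ is the full subcategory of finitely generated left $\Lambda$-modules of finite projective dimension. For a subcategory $\mathcal{C}$, a right $\mathcal{C}$-approximation of $M$ is a morphism $\psi:B\to M$ with $B\in\mathcal{C}$ through which every morphism $C\to M$ with $C\in\mathcal{C}$ factors; it is minimal if every endomorphism $g$ of $B$ with $\psi g=\psi$ is an automorphism; $\mathcal{C}$ is contravariantly finite if every module has a right $\mathcal{C}$-approximation. *)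

(* Defs.v *)
(* Finite-dimensional left modules over the truncated path
   algebra Lambda = KQ/I are encoded concretely: a module is a finite-dim
   K-space K^d (column vectors) together with matrices for the vertex
   idempotents e_i and the arrows, satisfying the defining relations of KQ/I. *)
From HB Require Import structures.
From mathcomp Require Import all_boot all_order all_algebra.
From mathcomp Require Import boolp.
Set Implicit Arguments. Unset Strict Implicit. Unset Printing Implicit Defensive.
Import GRing.Theory.
Local Open Scope ring_scope.

Section TruncatedPathAlgebra.
Variable K : fieldType.
Variable n : nat.
Variable Ar : finType.
Variables src tgt : Ar -> 'I_n.
Variable L : nat.                 (* I generated by all paths of length L+1 *)

(* ---------- paths in Q (listed in traversal order: first arrow first) *)
Fixpoint walk_from (i : 'I_n) (s : seq Ar) : bool :=
  if s is a :: s' then (src a == i) && walk_from (tgt a) s' else true.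
Fixpoint walk_end (i : 'I_n) (s : seq Ar) : 'I_n :=
  if s is a :: s' then walk_end (tgt a) s' else i.

Definition on_cycle (j : 'I_n) : Prop :=
  exists s, s != [::] /\ walk_from j s /\ walk_end j s = j.
Definition precyclic (i : 'I_n) : Prop :=
  exists s, walk_from i s /\ on_cycle (walk_end i s).

Record lmod := LMod {
  ldim : nat;
  le : 'I_n -> 'M[K]_ldim;
  la : Ar -> 'M[K]_ldim
}.

Definition word_act (M : lmod) (s : seq Ar) : 'M[K]_(ldim M) :=
  foldr (fun a m => la M a *m m) 1%:M s.

Definition is_lmod (M : lmod) : Prop :=
  [/\ \sum_(i < n) le M i = 1%:M,
      forall i j, le M i *m le M j = if i == j then le M i else 0,
      forall a, la M a = le M (tgt a) *m la M a *m le M (src a)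
    & forall s : seq Ar, size s = L.+1 -> word_act M s = 0].

Definition is_hom (M N : lmod) (f : 'M[K]_(ldim N, ldim M)) : Prop :=
  (forall i, f *m le M i = le N i *m f) /\ (forall a, f *m la M a = la N a *m f).

Definition surj (m p : nat) (f : 'M[K]_(m, p)) : Prop :=
  forall y : 'cV[K]_m, exists x : 'cV[K]_p, f *m x = y.
Definition inj (m p : nat) (f : 'M[K]_(m, p)) : Prop :=
  forall x : 'cV[K]_p, f *m x = 0 -> x = 0.
Definition exact_at (p q r : nat) (f : 'M[K]_(q, p)) (g : 'M[K]_(r, q)) : Prop :=
  g *m f = 0 /\ forall y : 'cV[K]_q, g *m y = 0 -> exists x, f *m x = y.

Definition projective (P : lmod) : Prop :=
  is_lmod P /\
  forall (X Y : lmod) (g : 'M[K]_(ldim Y, ldim X)) (h : 'M[K]_(ldim Y, ldim P)),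
    is_lmod X -> is_lmod Y -> is_hom g -> surj g -> is_hom h ->
    exists k : 'M[K]_(ldim X, ldim P), is_hom k /\ g *m k = h.

Inductive pd_le : nat -> lmod -> Prop :=
| pd_le0 M : projective M -> pd_le 0 M
| pd_leS m (M P Q : lmod) (i : 'M[K]_(ldim P, ldim Q)) (p : 'M[K]_(ldim M, ldim P)) :
    is_lmod M -> projective P -> is_lmod Q -> is_hom i -> is_hom p ->
    inj i -> surj p -> exact_at i p -> pd_le m Q -> pd_le m.+1 M.

Definition Pfin (M : lmod) : Prop := is_lmod M /\ exists m, pd_le m M.

Definition right_approx (C : lmod -> Prop) (M B : lmod)
    (psi : 'M[K]_(ldim M, ldim B)) : Prop :=
  [/\ C B, is_hom psi &
      forall (X : lmod) (f : 'M[K]_(ldim M, ldim X)), C X -> is_hom f ->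
        exists g : 'M[K]_(ldim B, ldim X), is_hom g /\ psi *m g = f].

Definition min_right_approx (C : lmod -> Prop) (M B : lmod)
    (psi : 'M[K]_(ldim M, ldim B)) : Prop :=
  @right_approx C M B psi /\
  forall g : 'M[K]_(ldim B), is_hom g -> psi *m g = psi -> g \in unitmx.

Definition contravariantly_finite (C : lmod -> Prop) : Prop :=
  forall M, is_lmod M -> exists B (psi : 'M[K]_(ldim M, ldim B)), @right_approx C M B psi.

Definition submod (B : lmod) (U : 'cV[K]_(ldim B) -> Prop) : Prop :=
  [/\ U 0, (forall u v, U u -> U v -> U (u + v)),
      (forall (c : K) u, U u -> U (c *: u)),
      (forall i u, U u -> U (le B i *m u))
    & (forall a u, U u -> U (la B a *m u))].

Definition proper_sub (B : lmod) (U : 'cV[K]_(ldim B) -> Prop) : Prop :=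
  exists v, ~ U v.

Definition maximal_submod (B : lmod) (U : 'cV[K]_(ldim B) -> Prop) : Prop :=
  [/\ submod U, proper_sub U &
      forall V : 'cV[K]_(ldim B) -> Prop, submod V -> proper_sub V -> (forall v, U v -> V v) -> forall v, V v -> U v].

Definition local_mod (B : lmod) : Prop :=
  exists U : 'cV[K]_(ldim B) -> Prop, maximal_submod U /\
    forall V : 'cV[K]_(ldim B) -> Prop, maximal_submod V -> forall v, V v <-> U v.

Definition indecomposable (B : lmod) : Prop :=
  ldim B <> 0%N /\
  forall U V : 'cV[K]_(ldim B) -> Prop, submod U -> submod V ->
    (forall x, exists u v, [/\ U u, V v & x = u + v]) ->
    (forall x, U x -> V x -> x = 0) ->
    (forall x, U x -> x = 0) \/ (forall x, V x -> x = 0).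

Definition Smod (i : 'I_n) : lmod :=
  @LMod 1 (fun j => ((j == i)%:R)%:M) (fun _ => 0).

(* ---------- A_i = Lambda e_i / eps J e_i, with basis the residues of
   e_i and of the paths of length 1..L starting at e_i ending at a precyclic
   vertex (paths of length >= 1 ending at non-precyclic vertices span eps J e_i) *)
Fixpoint words (k : nat) : seq (seq Ar) :=
  if k is k'.+1 then [seq a :: s | a <- enum Ar, s <- words k'] else [:: [::]].

Definition Abasis (i : 'I_n) : seq (seq Ar) :=
  [seq s <- flatten [seq words k | k <- iota 0 L.+1] |
     walk_from i s && ((s == [::]) || `[< precyclic (walk_end i s) >])].

Definition Amod (i : 'I_n) : lmod :=
  @LMod (size (Abasis i))
    (fun j => \matrix_(r, c) ((r == c) && (walk_end i (nth [::] (Abasis i) c) == j))%:R)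
    (fun a => \matrix_(r, c)
                (nth [::] (Abasis i) r == rcons (nth [::] (Abasis i) c) a)%:R).

Definition Aepi (i : 'I_n) : 'M[K]_(1, size (Abasis i)) :=
  \matrix_(r, c) (nth [::] (Abasis i) c == [::])%:R.

End TruncatedPathAlgebra.

Arguments right_approx {K n Ar} C M B psi.
Arguments min_right_approx {K n Ar} C M B psi.

(* Main.v *)
(** Write [J] for the radical of [Lambda]. For a module [M], let "top-free" mean
    that the paths of maximal length [L] ending at a precyclic vertex are
    linearly independent over the top of [M]: if [\sum_p p x_p] vanishes then
    each [x_p] lies in [J M]. Every precyclic vertex starts arbitrarily long
    paths through precyclic vertices, so a nonzero element of a top-free module
    sitting at a precyclic vertex can be pushed forward to path length exactly
    [L], where its leading terms are detected.

    Hence, if [M] is top-free, a cover [P -> M] with kernel inside [J P] has a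
    kernel supported on nonprecyclic vertices; the latter have bounded height,
    so such a kernel has finite projective dimension. Conversely projectives are
    top-free, and so is the cokernel of an injection between top-free modules.
    Finite projective dimension is thus equivalent to being top-free.

    For an arbitrary [M] take a free cover [F -> M] with kernel [R]. The quotient
    [F / eps R] is top-free because [F] is. If [X] has finite projective
    dimension and cover [P], a map [X -> M] lifts to [P -> F]; it sends
    [ker (P -> X)], which is nonprecyclic, into [eps R], so it induces
    [X -> F / eps R]. For [M = S_i] and [F = Lambda e_i] this quotient is [A_i]. *)
Require Import Defs.
From HB Require Import structures.
From mathcomp Require Import all_boot all_order all_algebra.
From mathcomp Require Import boolp.
Set Implicit Arguments. Unset Strict Implicit. Unset Printing Implicit Defensive.
Import GRing.Theory.
Local Open Scope ring_scope.

(** * Walks in the quiver *)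

Section Quiver.
Variables (n : nat) (Ar : finType) (src tgt : Ar -> 'I_n).

Lemma mem_words k (s : seq Ar) : (s \in words Ar k) = (size s == k).
Proof.
elim: k s => [|k IHk] [|a s] //=.
  by apply/negbTE/allpairsP => -[[b t] []].
rewrite eqSS -IHk; apply/allpairsP/idP => [[[b t] /= [_ ht [_ ->]]] //|hs].
by exists (a, s); rewrite mem_enum.
Qed.

Lemma words_uniq k : uniq (words Ar k).
Proof.
elim: k => //= k IHk; apply: allpairs_uniq; rewrite ?enum_uniq //.
by move=> [a s] [b t] _ _ /= [-> ->].
Qed.

Lemma walk_from_cat i (s t : seq Ar) :
  walk_from src tgt i (s ++ t)
  = walk_from src tgt i s && walk_from src tgt (walk_end tgt i s) t.
Proof. by elim: s i => //= a s IHs i; rewrite IHs andbA. Qed.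

Lemma walk_end_cat i (s t : seq Ar) :
  walk_end tgt i (s ++ t) = walk_end tgt (walk_end tgt i s) t.
Proof. by elim: s i => //=. Qed.

Lemma precyclic_src a : precyclic src tgt (tgt a) -> precyclic src tgt (src a).
Proof. by move=> [s [ws cs]]; exists (a :: s); rewrite /= eqxx. Qed.

(** If the path leading to a cycle is empty, [j] itself lies on a cycle, and the first arrow of that
    cycle serves. *)
Lemma precyclic_step j : precyclic src tgt j ->
  exists a, src a = j /\ precyclic src tgt (tgt a).
Proof.
move=> [[|a s] /= [ws cs]];
  last by case/andP: ws => /eqP <- ws; exists a; split=> //; exists s.
case: (cs) => -[|a c] [] //= _ [/andP[/eqP sa wc] ec]; exists a; split=> //.
by exists c; rewrite ec.
Qed.

Lemma precyclic_walk j k : precyclic src tgt j ->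
  exists r, [/\ size r = k, walk_from src tgt j r
              & precyclic src tgt (walk_end tgt j r)].
Proof.
elim: k j => [|k IHk] j pj; first by exists [::].
have [a [<- /IHk[r [sr wr er]]]] := precyclic_step pj.
by exists (a :: r); rewrite /= sr eqxx.
Qed.

(** Pigeonhole: a path of length at least [n] meets some vertex twice, and the stretch between the
    two visits is an oriented cycle reached from [j]. *)
Lemma nonprecyclic_size j s : ~ precyclic src tgt j ->
  walk_from src tgt j s -> (size s < n)%N.
Proof.
move=> npj ws; rewrite ltnNge; apply/negP => le_n_s.
pose f (k : 'I_(size s).+1) := walk_end tgt j (take k s).
have /injectivePn[k1 [k2 neq_k eqf]] : ~~ injectiveb f.
  apply/negP => /injectiveP /leq_card; rewrite !card_ord ltnNge le_n_s //.
wlog lt_k : k1 k2 neq_k eqf / (k1 < k2)%N.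
  move=> H; case: (ltngtP k1 k2) => [| |/val_inj e]; first exact: H neq_k eqf.
    by apply: H => //; rewrite eq_sym.
  by rewrite e eqxx in neq_k.
apply: npj; exists (take k1 s).
move: ws; rewrite -{1}(cat_take_drop k2 s) walk_from_cat => /andP[+ _].
have -> : take k2 s = take k1 s ++ drop k1 (take k2 s).
  by rewrite -{1}(cat_take_drop k1 (take k2 s)) take_takel // ltnW.
rewrite walk_from_cat => /andP[-> w2]; split=> //.
exists (drop k1 (take k2 s)); split; last split=> //.
  by rewrite -size_eq0 size_drop size_take_min (minn_idPl _) ?subn_eq0 -?ltnNge // -ltnS.
by rewrite -walk_end_cat -[RHS]/(f k1) eqf /f; congr walk_end;
   rewrite -[in RHS](cat_take_drop k1 (take k2 s)) take_takel // ltnW.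
Qed.

End Quiver.

(** * Modules, homomorphisms and the radical filtration *)

Lemma eq_mul_cV (K : fieldType) (m p : nat) (A B : 'M[K]_(m, p)) :
  (forall x : 'cV_p, A *m x = B *m x) -> A = B.
Proof. by move=> eqAB; apply/trmx_inj/row_matrixP => k; rewrite -!tr_col !colE eqAB. Qed.

(** The right inverse is chosen column by column; it is only linear and need not respect any module
    structure. *)
Lemma surj_rinv (K : fieldType) (m p : nat) (f : 'M[K]_(m, p)) :
  surj f -> exists s, f *m s = 1%:M.
Proof.
move=> fs; have [h hP] := choice (fun c : 'I_m => fs (col c 1%:M)).
exists (\matrix_(r, c) h c r 0); apply/matrixP => r k.
have /(congr1 (fun A : 'cV_m => A r 0)) := hP k; rewrite !mxE => <-.
by apply: eq_bigr => j _; rewrite mxE.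
Qed.

Section Modules.
Variables (K : fieldType) (n : nat) (Ar : finType) (src tgt : Ar -> 'I_n) (L : nat).
Local Notation lmod := (lmod K n Ar).
Local Notation is_lmod := (@is_lmod K n Ar src tgt L).
Local Notation is_hom M N f := (@is_hom K n Ar M N f).
Local Notation vec M := 'cV[K]_(ldim M).
Local Notation walk_from := (walk_from src tgt).
Local Notation walk_end := (walk_end tgt).

(* The operator of the path [s]; [word_act] composes in the opposite order. *)
Fixpoint pact (M : lmod) (s : seq Ar) : 'M[K]_(ldim M) :=
  if s is a :: s' then pact M s' *m la M a else 1%:M.

Lemma pact_cat M s t : pact M (s ++ t) = pact M t *m pact M s.
Proof. by elim: s => [|a s IHs] /=; rewrite ?mulmx1 // IHs mulmxA. Qed.

Lemma pact_rcons M s a : pact M (rcons s a) = la M a *m pact M s.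
Proof. by rewrite -cats1 pact_cat /= mul1mx. Qed.

Lemma word_act_rev M s : word_act M (rev s) = pact M s.
Proof.
elim/last_ind: s => // s a IHs.
by rewrite rev_rcons /= IHs pact_rcons.
Qed.

Lemma hom_pact M N f s : is_hom M N f -> f *m pact M s = pact N s *m f.
Proof.
move=> [_ fa]; elim: s => [|a s IHs] /=; first by rewrite mulmx1 mul1mx.
by rewrite mulmxA IHs -!mulmxA fa.
Qed.

Lemma hom_id M : is_hom M M 1%:M.
Proof. by split=> ?; rewrite mulmx1 mul1mx. Qed.

Lemma hom_comp M N P f g : is_hom M N f -> is_hom N P g -> is_hom M P (g *m f).
Proof.
by move=> [fe fa] [ge ga]; split=> j; rewrite -mulmxA ?fe ?fa mulmxA ?ge ?ga -mulmxA.
Qed.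

Lemma pact_big M s : (size s > L)%N -> is_lmod M -> pact M s = 0.
Proof.
move=> hs [_ _ _ w0]; rewrite -(cat_take_drop L.+1 s) pact_cat.
by rewrite -(word_act_rev M (take _ _)) w0 ?mulmx0 // size_rev size_takel.
Qed.

Lemma le_sum M : is_lmod M -> \sum_(i < n) le M i = 1%:M.
Proof. by case. Qed.

Lemma le_mul M (lM : is_lmod M) i j : le M i *m le M j = if i == j then le M i else 0.
Proof. by case: lM. Qed.

Lemma le_la M (lM : is_lmod M) i a : le M i *m la M a = if i == tgt a then la M a else 0.
Proof.
case: (lM) => _ _ aM _; case: eqP => [->|/eqP/negbTE ne].
  by rewrite aM !mulmxA le_mul // eqxx.
by rewrite aM !mulmxA le_mul // ne !mul0mx.
Qed.

Lemma la_le M (lM : is_lmod M) i a : la M a *m le M i = if i == src a then la M a else 0.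
Proof.
case: (lM) => _ _ aM _; case: eqP => [->|/eqP/negbTE ne].
  by rewrite aM -!mulmxA le_mul // eqxx.
by rewrite aM -!mulmxA le_mul // eq_sym ne !mulmx0.
Qed.

Lemma pact_le M (lM : is_lmod M) i j s :
  le M j *m pact M s *m le M i
  = if walk_from i s && (walk_end i s == j) then pact M s *m le M i else 0.
Proof.
elim: s i => [|a s IHs] i /=.
  by rewrite mulmx1 mul1mx le_mul // eq_sym; case: eqP => [->|].
rewrite -!mulmxA la_le // eq_sym; case: eqP => [_|]; last by rewrite !mulmx0.
have -> : la M a = le M (tgt a) *m la M a by rewrite le_la ?eqxx.
by rewrite !mulmxA IHs /=; case: ifP; rewrite ?mul0mx.
Qed.

Lemma le_decomp M (lM : is_lmod M) (x : vec M) : x = \sum_j le M j *m x.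
Proof. by rewrite -mulmx_suml le_sum // mul1mx. Qed.

(* [inrad x] and [inradn l x] stand for [x \in J M] and [x \in J^l M]. *)
Definition inrad (M : lmod) (x : vec M) :=
  exists y : Ar -> vec M, x = \sum_a la M a *m y a.

Definition inradn (M : lmod) l (x : vec M) :=
  exists w : seq Ar -> vec M, x = \sum_(s <- words Ar l) pact M s *m w s.

Lemma inradn0 M x : @inradn M 0 x.
Proof. by exists (fun=> x); rewrite big_seq1 mul1mx. Qed.

Lemma inrad_0 M : @inrad M 0.
Proof. by exists (fun=> 0); rewrite big1 // => a _; rewrite mulmx0. Qed.

Lemma inrad_add M x y : @inrad M x -> inrad y -> inrad (x + y).
Proof.
move=> [u ->] [v ->]; exists (fun a => u a + v a).
by rewrite -big_split; apply: eq_bigr => a _; rewrite mulmxDr.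
Qed.

Lemma inrad_scale M c x : @inrad M x -> inrad (c *: x).
Proof.
move=> [u ->]; exists (fun a => c *: u a).
by rewrite scaler_sumr; apply: eq_bigr => a _; rewrite scalemxAr.
Qed.

Lemma inrad_opp M x : @inrad M x -> inrad (- x).
Proof. by rewrite -scaleN1r; apply: inrad_scale. Qed.

Lemma inrad_sum M (I : eqType) (r : seq I) (P : pred I) F :
  (forall i, i \in r -> P i -> @inrad M (F i)) -> inrad (\sum_(i <- r | P i) F i).
Proof.
move=> H; rewrite big_seq_cond; apply: big_ind => [|x y|i /andP[]]; last exact: H.
  exact: inrad_0.
exact: inrad_add.
Qed.

Lemma inrad_hom M N f x : is_hom M N f -> inrad x -> inrad (f *m x).
Proof.
move=> [_ fa] [u ->]; exists (fun a => f *m u a).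
by rewrite mulmx_sumr; apply: eq_bigr => a _; rewrite mulmxA fa mulmxA.
Qed.

Lemma inrad_la M a x : @inrad M (la M a *m x).
Proof.
exists (fun b => if b == a then x else 0).
by rewrite (bigD1 a) //= eqxx big1 ?addr0 // => b /negbTE->; rewrite mulmx0.
Qed.

Lemma inrad_le M j x : is_lmod M -> inrad x -> inrad (le M j *m x).
Proof.
move=> lM [u ->]; rewrite mulmx_sumr; apply: inrad_sum => a _ _.
rewrite mulmxA le_la //; case: eqP => _; first exact: inrad_la.
by rewrite mul0mx; apply: inrad_0.
Qed.

Lemma inrad_surj M N f y : is_hom M N f -> surj f -> inrad y ->
  exists2 x, inrad x & f *m x = y.
Proof.
move=> [fe fa] /surj_rinv[s fs] [u ->]; exists (\sum_a la M a *m (s *m u a)).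
  by exists (fun a => s *m u a).
rewrite mulmx_sumr; apply: eq_bigr => a _.
by rewrite mulmxA fa -mulmxA (mulmxA f) fs mul1mx.
Qed.

Lemma inradn_0 M l : @inradn M l 0.
Proof. by exists (fun=> 0); rewrite big1 // => a _; rewrite mulmx0. Qed.

Lemma inradn_add M l x y : @inradn M l x -> inradn l y -> inradn l (x + y).
Proof.
move=> [u ->] [v ->]; exists (fun a => u a + v a).
by rewrite -big_split; apply: eq_bigr => a _; rewrite mulmxDr.
Qed.

Lemma inradn_sum M l (I : eqType) (r : seq I) F :
  (forall i, i \in r -> @inradn M l (F i)) -> inradn l (\sum_(i <- r) F i).
Proof.
move=> H; rewrite big_seq; apply: big_ind => [|x y|//].
  exact: inradn_0.
exact: inradn_add.
Qed.

Lemma sum_words_pred1 (V : nmodType) (t : seq Ar) (F : seq Ar -> V) :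
  \sum_(s <- words Ar (size t)) (if s == t then F s else 0) = F t.
Proof.
rewrite (bigD1_seq t) ?words_uniq ?mem_words //= eqxx big1 ?addr0 //.
by move=> s /negbTE->.
Qed.

Lemma inradn_pact M s x : @inradn M (size s) (pact M s *m x).
Proof.
exists (fun t => if t == s then x else 0).
rewrite -[LHS](sum_words_pred1 s (fun t => pact M t *m x)).
by apply: eq_bigr => t _; case: eqP => _; rewrite ?mulmx0.
Qed.

Lemma inradn_pact_inrad M s x : inrad x -> @inradn M (size s).+1 (pact M s *m x).
Proof.
move=> [y ->]; rewrite mulmx_sumr; apply: inradn_sum => a _.
by rewrite mulmxA; apply: (inradn_pact (a :: s)).
Qed.

Lemma inradn_big M l x : is_lmod M -> (L < l)%N -> @inradn M l x -> x = 0.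
Proof.
move=> lM hl [w ->]; rewrite big_seq big1 // => s; rewrite mem_words => /eqP sz.
by rewrite pact_big ?mul0mx // sz.
Qed.

Lemma pact_inradn M s l x : is_lmod M -> (L < size s + l)%N -> inradn l x ->
  pact M s *m x = 0.
Proof.
move=> lM hl [w ->]; rewrite mulmx_sumr big_seq big1 // => t.
rewrite mem_words => /eqP sz.
by rewrite mulmxA -pact_cat pact_big ?mul0mx // size_cat sz addnC.
Qed.

Lemma inrad_inradn1 M x : @inrad M x -> inradn 1 x.
Proof.
move=> [y ->]; apply: inradn_sum => a _; rewrite -[la M a]mul1mx.
exact: (inradn_pact [:: a]).
Qed.

Lemma sum_words_cat (V : nmodType) k l (F : seq Ar -> V) :
  \sum_(s <- words Ar (k + l)) F s
  = \sum_(q <- words Ar k) \sum_(r <- words Ar l) F (q ++ r).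
Proof.
elim: k F => [|k IHk] F; first by rewrite big_seq1.
rewrite addSn /= !big_allpairs_dep; apply: eq_bigr => a _.
by rewrite (IHk (fun s => F (a :: s))).
Qed.

(** Subtracting an element of [U] leaves a remainder in $JM$; repeating this on the remainder pushes
    it into ever higher powers of $J$, and $J^{L+1}M=0$. *)
Lemma nakayama M (U : vec M -> Prop) : is_lmod M -> submod U ->
  (forall z, exists2 u, U u & inrad (z - u)) -> forall z, U z.
Proof.
move=> lM [U0 Ua Uc Ue Ul] H z; rewrite -[z]mul1mx.
have Up s u : U u -> U (pact M s *m u).
  elim: s u => [|a s IHs] u hu /=; first by rewrite mul1mx.
  by rewrite -mulmxA; apply/IHs/Ul.
(* Here [s] is the path already collected in front of the remainder, and [m] bounds the number of
   substitutions still to be made. *)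
suff X m : forall s z, (L < size s + m)%N -> U (pact M s *m z) by apply: (X L.+1 [::]).
elim: m => [|m IHm] s x hs; first by rewrite pact_big ?mul0mx // -(addn0 (size s)).
have [u hu [y hy]] := H x.
rewrite -[x](subrK u) mulmxDr; apply: (Ua); last exact: Up.
rewrite hy mulmx_sumr; apply: (big_ind (fun v => U v)) => [|v w|a _] //;
  [exact: Ua|rewrite mulmxA].
by apply: (IHm (a :: s)); rewrite /= addSn -addnS.
Qed.

(** As [f] kills the kernel of [p], its composite with a linear section of [p] is a homomorphism,
    although the section need not be one. *)
Lemma hom_factor M N P p f : is_hom M N p -> surj p -> is_hom M P f ->
  (forall x : vec M, p *m x = 0 -> f *m x = 0) ->
  exists2 g : 'M_(ldim P, ldim N), is_hom N P g & g *m p = f.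
Proof.
move=> [pe pa] ps [fe fa] kerpf; have [s sP] := surj_rinv ps.
have E : f *m s *m p = f.
  apply: eq_mul_cV => x; apply/eqP; rewrite -subr_eq0 -!mulmxA -mulmxBr; apply/eqP.
  by apply: kerpf; rewrite mulmxBr !mulmxA sP mul1mx subrr.
exists (f *m s) => //; split=> j.
  by rewrite -[le N j]mulmx1 -sP (mulmxA (le N j)) -pe !mulmxA E fe.
by rewrite -[la N j]mulmx1 -sP (mulmxA (la N j)) -pa !mulmxA E fa.
Qed.

(** * Transfer of the module relations, quotients and kernels *)

Lemma surj_comp m p q (f : 'M[K]_(m, p)) (g : 'M[K]_(q, m)) :
  surj f -> surj g -> surj (g *m f).
Proof.
by move=> fs gs y; have [z <-] := gs y; have [x <-] := fs z; exists x; rewrite mulmxA.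
Qed.

Lemma inj_lmod M N f : is_lmod M -> is_hom N M f -> inj f -> is_lmod N.
Proof.
move=> lM hf fi; have can d (A B : 'M_(_, d)) : f *m A = f *m B -> A = B.
  move=> e; apply: eq_mul_cV => x; apply/eqP; rewrite -subr_eq0 -mulmxBl; apply/eqP.
  by apply: fi; rewrite mulmxA mulmxBr e subrr mul0mx.
have [fe fa] := hf; split.
- apply: can; rewrite mulmx_sumr mulmx1 -[RHS]mul1mx -(le_sum lM) mulmx_suml.
  exact: eq_bigr.
- move=> i j; apply: can; rewrite mulmxA fe -mulmxA fe mulmxA le_mul //.
  by case: eqP; rewrite ?mul0mx ?mulmx0.
- move=> a; apply: can; rewrite !mulmxA fe -(mulmxA _ f) fa mulmxA le_la // eqxx.
  by rewrite -mulmxA fe mulmxA la_le // eqxx.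
- move=> s hs; apply: can; rewrite -(revK s) word_act_rev (hom_pact _ hf).
  by rewrite pact_big ?mul0mx ?mulmx0 // size_rev hs.
Qed.

Lemma surj_lmod M N f : is_lmod M -> is_hom M N f -> surj f -> is_lmod N.
Proof.
move=> lM hf /surj_rinv[t ft].
have can d (A B : 'M_(d, _)) : A *m f = B *m f -> A = B.
  by move=> e; rewrite -[A]mulmx1 -[B]mulmx1 -ft !mulmxA e.
have [fe fa] := hf; split.
- apply: can; rewrite mulmx_suml mul1mx -[RHS]mulmx1 -(le_sum lM) mulmx_sumr.
  exact: eq_bigr.
- move=> i j; apply: can; rewrite -mulmxA -fe mulmxA -fe -mulmxA le_mul //.
  by case: eqP; rewrite ?mul0mx ?mulmx0.
- move=> a; apply: can; rewrite -!mulmxA -fe (mulmxA (la N a)) -fa -mulmxA la_le // eqxx.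
  by rewrite mulmxA -fe -mulmxA le_la // eqxx fa.
- move=> s hs; apply: can; rewrite -(revK s) word_act_rev -(hom_pact _ hf).
  by rewrite pact_big ?mul0mx ?mulmx0 // size_rev hs.
Qed.

(** [D] is only linear, but its kernel is a submodule. The quotient is realised on a space of
    dimension the rank of [D]: [V] is surjective with the same kernel as [D], and the operators are
    transported through a linear section [U] of [V]. *)
Lemma quot_exists M d (D : 'M[K]_(d, ldim M)) : is_lmod M ->
  (forall j (x : vec M), D *m x = 0 -> D *m (le M j *m x) = 0) ->
  (forall a (x : vec M), D *m x = 0 -> D *m (la M a *m x) = 0) ->
  exists N (q : 'M_(ldim N, ldim M)),
  [/\ is_lmod N, is_hom M N q, surj q & forall x : vec M, q *m x = 0 <-> D *m x = 0].
Proof.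
move=> lM De Da; pose V := row_base D; pose U := pinvmx V.
have VU : V *m U = 1%:M by rewrite mulmxVp // row_base_free.
have kV (x : vec M) : V *m x = 0 <-> D *m x = 0.
  split=> e; first by rewrite -(mulmx_base D) -mulmxA e mulmx0.
  rewrite -[LHS]mul1mx; have <- : pinvmx (col_base D) *m col_base D = 1%:M.
    by rewrite mulVpmx // col_base_full.
  by rewrite -mulmxA (mulmxA (col_base D)) mulmx_base e mulmx0.
clearbody V U.
have kU (x : vec M) : V *m (x - U *m V *m x) = 0.
  by rewrite mulmxBr !mulmxA VU mul1mx subrr.
pose N := @LMod K n Ar _ (fun j => V *m le M j *m U) (fun a => V *m la M a *m U).
have hV : is_hom M N V.
  split=> j /=; apply: eq_mul_cV => x; apply/eqP; rewrite -subr_eq0 -!mulmxA -!mulmxBr;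
    apply/eqP/kV; [apply: De | apply: Da]; apply/kV; rewrite mulmxA; exact: kU.
have sV : surj V by move=> y; exists (U *m y); rewrite mulmxA VU mul1mx.
exists N, V; split=> //; exact: surj_lmod hV sV.
Qed.

Lemma ker_exists M N f : is_lmod M -> is_hom M N f ->
  exists Q (i : 'M_(ldim M, ldim Q)), [/\ is_lmod Q, is_hom Q M i, inj i & exact_at i f].
Proof.
move=> lM [fe fa]; pose R := row_base (kermx f^T); pose U := R^T; pose V := (pinvmx R)^T.
have VU : V *m U = 1%:M by rewrite -trmx_mul mulmxVp ?trmx1 // row_base_free.
have fU : f *m U = 0.
  apply: trmx_inj; rewrite trmx_mul trmxK trmx0.
  by apply/sub_kermxP; rewrite eq_row_base.
have UV (x : vec M) : f *m x = 0 -> U *m (V *m x) = x.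
  move=> e; apply: trmx_inj; rewrite !trmx_mul !trmxK mulmxKpV // eq_row_base.
  by apply/sub_kermxP; rewrite -trmx_mul e trmx0.
clearbody U V.
pose Q := @LMod K n Ar _ (fun j => V *m le M j *m U) (fun a => V *m la M a *m U).
have hU : is_hom Q M U.
  split=> j /=; apply: eq_mul_cV => x; rewrite -!mulmxA UV //.
    by rewrite mulmxA fe -mulmxA (mulmxA f) fU mul0mx mulmx0.
  by rewrite mulmxA fa -mulmxA (mulmxA f) fU mul0mx mulmx0.
have iU : inj U by move=> x e; rewrite -[x]mul1mx -VU -mulmxA e mulmx0.
exists Q, U; split=> //; first exact: inj_lmod hU iU.
by split=> // y e; exists (V *m y); rewrite UV.
Qed.

End Modules.

(** * The modules spanned by paths *)

Section PathModule.
Variables (K : fieldType) (n : nat) (Ar : finType) (src tgt : Ar -> 'I_n) (L : nat).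
Local Notation lmod := (lmod K n Ar).
Local Notation is_lmod := (@is_lmod K n Ar src tgt L).
Local Notation is_hom M N f := (@is_hom K n Ar M N f).
Local Notation vec M := 'cV[K]_(ldim M).
Local Notation walk_from := (walk_from src tgt).
Local Notation walk_end := (walk_end tgt).
Local Notation precyclic := (precyclic src tgt).

Section Def.
Variables (S : pred 'I_n) (i : 'I_n).

(** Convertible with [Abasis] when [S] tests precyclicity, so that results on [pmod] apply to [Amod]
    directly. *)
Definition pbasis : seq (seq Ar) :=
  [seq s <- flatten [seq words Ar k | k <- iota 0 L.+1] |
     walk_from i s && ((s == [::]) || S (walk_end i s))].

Local Arguments pbasis : simpl never.

(* [Lambda e_i] modulo the paths of positive length ending outside [S]: [S] is
   everything for [Lambda e_i], and the set of precyclic vertices for [A_i]. *)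
Definition pmod : lmod :=
  @LMod K n Ar (size pbasis)
    (fun j => \matrix_(r, c) ((r == c) && (walk_end i (nth [::] pbasis c) == j))%:R)
    (fun a => \matrix_(r, c) (nth [::] pbasis r == rcons (nth [::] pbasis c) a)%:R).

(** The value is 0 when [s] is not a basis path, so that the action formulas below hold for every
    list of arrows. *)
Definition pvec (s : seq Ar) : 'cV[K]_(size pbasis) :=
  \col_r (nth [::] pbasis r == s)%:R.

Lemma mem_pbasis s : (s \in pbasis) =
  [&& walk_from i s, (s == [::]) || S (walk_end i s) & (size s <= L)%N].
Proof.
rewrite mem_filter -andbA; congr (_ && (_ && _)).
apply/flatten_mapP/idP => [[k]|hs].
  by rewrite mem_iota mem_words => /= hk /eqP->; rewrite -ltnS.
by exists (size s); rewrite ?mem_words ?mem_iota.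
Qed.

Lemma pbasis_uniq : uniq pbasis.
Proof.
apply: filter_uniq; elim: L.+1 0%N => //= m IHm a.
rewrite cat_uniq words_uniq IHm andbT; apply/hasPn => s /flatten_mapP[k].
rewrite mem_iota mem_words => /andP[lt_ak _] /eqP sk /=.
by rewrite mem_words sk gtn_eqF.
Qed.

Lemma pvec_nth (c : 'I_(size pbasis)) : pvec (nth [::] pbasis c) = delta_mx c 0.
Proof.
by apply/matrixP => r k; rewrite !mxE ord1 eqxx andbT nth_uniq ?pbasis_uniq.
Qed.

Lemma pvec_notin s : s \notin pbasis -> pvec s = 0.
Proof.
move=> hs; apply/matrixP => r k; rewrite !mxE; case: eqP => // e.
by rewrite -e mem_nth in hs.
Qed.

Lemma pvec_ext m (A B : 'M[K]_(m, size pbasis)) :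
  (forall s, s \in pbasis -> A *m pvec s = B *m pvec s) -> A = B.
Proof.
move=> e; apply/trmx_inj/row_matrixP => c.
by rewrite -!tr_col !colE -pvec_nth e // mem_nth.
Qed.

Lemma mul_pvec m (F : 'I_m -> seq Ar -> K) s : s \in pbasis ->
  (\matrix_(r, c) F r (nth [::] pbasis c) : 'M_(m, size pbasis)) *m pvec s
  = \col_r F r s.
Proof.
move=> hs; have hc : (index s pbasis < size pbasis)%N by rewrite index_mem.
rewrite -{1}(nth_index [::] hs) -[index s _]/(val (Ordinal hc)) pvec_nth -colE.
by apply/matrixP => r k; rewrite !mxE nth_index.
Qed.

Lemma pvec_sum (z : 'cV[K]_(size pbasis)) :
  z = \sum_(c < size pbasis) z c 0 *: pvec (nth [::] pbasis c).
Proof.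
rewrite {1}[z]matrix_sum_delta; apply: eq_bigr => c _.
by rewrite big_ord1 pvec_nth.
Qed.

(** Once a path has ended outside [S], so do all its extensions; the discarded paths therefore span
    a submodule. *)
Hypothesis S_src : forall a, S (tgt a) -> S (src a).

Lemma la_pvec a s : la pmod a *m pvec s = pvec (rcons s a).
Proof.
have [hs|hs] := boolP (s \in pbasis).
  by rewrite [LHS](mul_pvec (fun r t => (nth [::] pbasis r == rcons t a)%:R)).
rewrite (pvec_notin hs) mulmx0 pvec_notin //; apply: contra hs.
rewrite !mem_pbasis -cats1 walk_from_cat walk_end_cat size_cat /= addn1 andbT.
case/and3P => /andP[-> /eqP sa]; rewrite -size_eq0 size_cat addn1 /= => hS /ltnW ->.
by rewrite -sa S_src ?orbT.
Qed.

Lemma le_pvec j s : le pmod j *m pvec s = if walk_end i s == j then pvec s else 0.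
Proof.
have [hs|hs] := boolP (s \in pbasis); last by rewrite pvec_notin // mulmx0 if_same.
apply/matrixP => r k.
rewrite (_ : le pmod j = \matrix_(r, c)
  ((nth [::] pbasis r == nth [::] pbasis c) && (walk_end i (nth [::] pbasis c) == j))%:R).
  rewrite (mul_pvec (fun r t => ((nth [::] pbasis r == t) && (walk_end i t == j))%:R)) //.
  by case: (walk_end i s == j); rewrite !mxE ?andbT ?andbF.
by apply/matrixP => u v; rewrite !mxE nth_uniq ?pbasis_uniq.
Qed.

Lemma pact_pvec s t : pact pmod s *m pvec t = pvec (t ++ s).
Proof.
elim: s t => [|a s IHs] t /=; first by rewrite mul1mx cats0.
by rewrite -mulmxA la_pvec IHs cat_rcons.
Qed.

Lemma pmod_lmod : is_lmod pmod.
Proof.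
split.
- apply: pvec_ext => s hs; rewrite mulmx_suml mul1mx (bigD1 (walk_end i s)) //=.
  rewrite le_pvec eqxx big1 ?addr0 // => j /negbTE ne.
  by rewrite le_pvec eq_sym ne.
- move=> j k; apply: pvec_ext => s _; rewrite -mulmxA le_pvec fun_if mulmx0 le_pvec.
  case: (eqVneq j k) => [->|ne]; first by rewrite le_pvec; case: eqP.
  by rewrite mul0mx; case: eqP => // ->; rewrite eq_sym (negbTE ne).
- move=> a; apply: pvec_ext => s hs; rewrite -!mulmxA le_pvec fun_if mulmx0 la_pvec.
  case: eqP => [_|ne]; first by rewrite le_pvec -cats1 walk_end_cat /= eqxx.
  rewrite mulmx0 pvec_notin // mem_pbasis -cats1 walk_from_cat /= eq_sym.
  by move/eqP/negbTE: ne => ->; rewrite andbF.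
- move=> s hs; apply: pvec_ext => t _; rewrite -(revK s) word_act_rev pact_pvec mul0mx.
  rewrite pvec_notin // mem_pbasis size_cat size_rev hs addnS ltnNge.
  by rewrite leq_addl !andbF.
Qed.

(** Every nontrivial basis path ends with an arrow and so lies in the radical; [c] is the
    coefficient of the trivial path. *)
Lemma pvec_nil_coord (z : 'cV[K]_(size pbasis)) : exists c,
  inrad (M := pmod) (z - c *: pvec [::]).
Proof.
rewrite [z]pvec_sum; have h0 : [::] \in pbasis by rewrite mem_pbasis.
have hc : (index [::] pbasis < size pbasis)%N by rewrite index_mem.
exists (z (Ordinal hc) 0); rewrite (bigD1 (Ordinal hc) isT).
rewrite -[nth _ _ (Ordinal hc)]/(nth [::] pbasis (index [::] pbasis)) nth_index //.
rewrite addrC addKr; apply: inrad_sum => c _ ne; apply: inrad_scale.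
have [t e] : exists t, nth [::] pbasis c = t by eexists.
rewrite e; case/lastP: t e => [e|s a _].
  case/eqP: ne; apply: val_inj.
  rewrite -[LHS](index_uniq [::] (ltn_ord c) pbasis_uniq).
  exact: (congr1 (index^~ pbasis) e).
by rewrite -la_pvec; apply: inrad_la.
Qed.

End Def.

(** Universal property of $\Lambda e_i$. Lists outside the basis cause no conflict: they either
    exceed length [L] or are not paths from [i], and kill $x=e_ix$ in both cases. *)
Lemma pfree_hom i (N : lmod) (x : vec N) : is_lmod N -> le N i *m x = x ->
  exists2 f : 'M_(_, size (pbasis xpredT i)), is_hom (pmod xpredT i) N f
    & forall s, f *m pvec xpredT i s = pact N s *m x.
Proof.
move=> lN ex; pose f := \matrix_(r < ldim N, c < size (pbasis xpredT i))
  (pact N (nth [::] (pbasis xpredT i) c) *m x) r 0.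
have fs s : f *m pvec xpredT i s = pact N s *m x.
  have [hs|hs] := boolP (s \in pbasis xpredT i).
    rewrite (mul_pvec (fun r s => (pact N s *m x) r 0) hs).
    by apply/matrixP => r k; rewrite mxE ord1.
  rewrite (pvec_notin hs) mulmx0; move: hs; rewrite mem_pbasis orbT negb_and -ltnNge.
  case/orP=> [nw|hs]; last by rewrite (pact_big hs lN) mul0mx.
  rewrite -ex mulmxA [RHS](le_decomp lN).
  by rewrite big1 // => j _; rewrite !mulmxA (pact_le lN) (negbTE nw) mul0mx.
exists f => //; split=> j; apply: pvec_ext => s hs; rewrite -!mulmxA; last first.
  by rewrite la_pvec // !fs pact_rcons mulmxA.
rewrite le_pvec fun_if mulmx0 !fs -ex !mulmxA (pact_le lN).
move: hs; rewrite mem_pbasis => /andP[-> _] /=.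
by case: eqP; rewrite ?mul0mx.
Qed.

End PathModule.

(** * Independence of maximal paths over the top *)

Section TopFree.
Variables (K : fieldType) (n : nat) (Ar : finType) (src tgt : Ar -> 'I_n) (L : nat).
Local Notation lmod := (lmod K n Ar).
Local Notation is_lmod := (@is_lmod K n Ar src tgt L).
Local Notation is_hom M N f := (@is_hom K n Ar M N f).
Local Notation vec M := 'cV[K]_(ldim M).
Local Notation walk_from := (walk_from src tgt).
Local Notation walk_end := (walk_end tgt).
Local Notation precyclic := (precyclic src tgt).

(* Over the precyclic vertices this says that [M] is free: the paths of maximal
   length are linearly independent over the top of [M]. *)
Definition top_free (M : lmod) := forall j (x : seq Ar -> vec M), precyclic j ->
  le M j *m (\sum_(s <- words Ar L) pact M s *m x s) = 0 ->
  forall i s, size s = L -> walk_from i s -> walk_end i s = j ->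
  inrad (le M i *m x s).

(** Transfers [top_free] from length [L] to a shorter length [l]: all paths of length [l] are
    extended by one fixed path [r] of the missing length. *)
Lemma top_free_coef M P phi l j r (w : seq Ar -> vec P) :
  is_hom P M phi -> top_free M -> (l <= L)%N -> size r = (L - l)%N ->
  walk_from j r -> precyclic (walk_end j r) ->
  phi *m (pact P r *m \sum_(q <- words Ar l) pact P q *m w q) = 0 ->
  forall i q, size q = l -> walk_from i q -> walk_end i q = j ->
  inrad (phi *m (le P i *m w q)).
Proof.
move=> hphi fM le_lL sr wr pr phi0 i q sq wq eq.
(* The coefficient family is supported on the paths whose final stretch is [r]. *)
pose x s := if drop l s == r then phi *m w (take l s) else 0.
have := fM _ x pr _ i (q ++ r); rewrite size_cat sq sr subnKC // walk_from_cat wq eq.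
rewrite wr walk_end_cat eq /x -sq drop_size_cat // take_size_cat // eqxx.
move=> H; rewrite mulmxA (proj1 hphi i) -mulmxA; apply: H => //.
rewrite -[in words Ar L](subnKC le_lL) sum_words_cat.
rewrite (_ : \sum_(q <- words Ar l) _
    = phi *m (pact P r *m \sum_(q <- words Ar l) pact P q *m w q)).
  by rewrite phi0 mulmx0.
rewrite mulmxA (hom_pact _ hphi) -mulmxA 2!mulmx_sumr.
rewrite big_seq [RHS]big_seq; apply: eq_bigr => p.
rewrite mem_words => /eqP sp; rewrite -sr.
transitivity (\sum_(t <- words Ar (size r))
    if t == r then pact M (p ++ t) *m (phi *m w p) else 0); last first.
  rewrite (sum_words_pred1 r (fun t => pact M (p ++ t) *m (phi *m w p))).
  by rewrite pact_cat mulmxA -(mulmxA _ (pact M p)) -(hom_pact _ hphi) !mulmxA.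
apply: eq_bigr => t _; rewrite /x drop_size_cat ?take_size_cat ?sp ?sq //.
by case: eqP; rewrite ?mulmx0.
Qed.

(** Only walks ending at [j] survive multiplication by $e_j$, and radical coefficients on these gain
    one power of $J$. *)
Lemma inradn_succ P l j (w : seq Ar -> vec P) : is_lmod P ->
  (forall i q, size q = l -> walk_from i q -> walk_end i q = j ->
     inrad (le P i *m w q)) ->
  inradn l.+1 (le P j *m \sum_(q <- words Ar l) pact P q *m w q).
Proof.
move=> lP H; rewrite mulmx_sumr; apply: inradn_sum => q; rewrite mem_words => /eqP sq.
rewrite [w q](le_decomp lP) 2!mulmx_sumr; apply: inradn_sum => i _.
rewrite !mulmxA (pact_le lP); case: ifP => [/andP[wq /eqP eq]|_].
  by rewrite -mulmxA -sq; apply/inradn_pact_inrad/H.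
by rewrite mul0mx; apply: inradn_0.
Qed.

(* Multiplying an element of [ker phi] by a path that stays among precyclic
   vertices pushes its leading terms to length [L], where [top_free M] applies. *)
Lemma top_free_cover M P phi : is_lmod P -> is_lmod M -> is_hom P M phi ->
  surj phi -> (forall z : vec P, phi *m z = 0 -> inrad z) -> top_free M ->
  forall j (z : vec P), precyclic j -> phi *m z = 0 -> le P j *m z = 0.
Proof.
move=> lP lM hphi sphi kerJ fM j z pj phiz.
suff X l : (l <= L.+1)%N -> inradn l (le P j *m z) by apply: (inradn_big lP _ (X L.+1 _)).
elim: l => [_|l IHl lt_lL]; first exact: inradn0.
have [w ew] := IHl (ltnW lt_lL).
have -> : le P j *m z = le P j *m (le P j *m z) by rewrite mulmxA (le_mul lP) eqxx.
rewrite ew; apply: inradn_succ => // i q sq wq eq.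
have [r [sr wr er]] := precyclic_walk (L - l) pj.
have : inrad (phi *m (le P i *m w q)).
  apply: (top_free_coef hphi fM _ sr wr er) => //.
  rewrite -ew mulmxA (hom_pact _ hphi) -mulmxA (mulmxA phi) (proj1 hphi).
  by rewrite -mulmxA phiz !mulmx0.
move=> /(inrad_surj hphi sphi)[v Jv ev].
(* The coefficient differs from the radical element [v] by an element of the kernel of [phi], which
   is radical by [kerJ]. *)
rewrite -[X in inrad X](subrKC v); apply: inrad_add => //.
by apply: kerJ; rewrite mulmxBr ev subrr.
Qed.

(* An element of [Q] that lies in [J^L P] is killed by every path of positive
   length, which by freeness of [Q] forces it into [J^L Q]. *)
Lemma top_free_quotient M P Q i p : is_lmod M -> is_lmod P -> is_lmod Q ->
  is_hom Q P i -> is_hom P M p -> inj i -> surj p -> exact_at i p ->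
  top_free P -> top_free Q -> top_free M.
Proof.
move=> lM lP lQ hi hp inji surjp [pi0 ex] fP fQ j x pj x0.
have [t pt] := surj_rinv surjp.
have [y py] : exists y : seq Ar -> vec P, forall s, p *m y s = x s.
  by exists (fun s => t *m x s) => s; rewrite mulmxA pt mul1mx.
(* The relation lifted to [P] need not vanish, but it lies in the kernel of [p] and hence comes from
   [Q]. *)
pose Y := le P j *m \sum_(s <- words Ar L) pact P s *m y s.
have [u0 eu0] : exists u0, i *m u0 = Y.
  apply: ex; rewrite mulmxA (proj1 hp) -mulmxA mulmx_sumr -[RHS]x0; congr (_ *m _).
  by apply: eq_bigr => s _; rewrite mulmxA (hom_pact _ hp) -mulmxA py.
pose u := le Q j *m u0.
have eju : le Q j *m u = u by rewrite mulmxA (le_mul lQ) eqxx.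
have eu : i *m u = Y by rewrite mulmxA (proj1 hi) -mulmxA eu0 mulmxA (le_mul lP) eqxx.
have X l : (l <= L)%N -> inradn l u.
  elim: l => [_|l IHl lt_lL]; first exact: inradn0.
  have [w ew] := IHl (ltnW lt_lL).
  rewrite -eju ew; apply: inradn_succ => // k q sq wq eq.
  have [r [sr wr er]] := precyclic_walk (L - l) pj.
  rewrite -[X in inrad X]mul1mx.
  apply: (top_free_coef (hom_id Q) fQ _ sr wr er) => //; first exact: ltnW.
  rewrite mul1mx -ew; apply: inji; rewrite mulmxA (hom_pact _ hi) -mulmxA eu.
  (* The path [r] has positive length [L - l], so it kills [Y], which lies in $J^LP$. *)
  apply: (pact_inradn lP (l := L)); first by rewrite -[ltnLHS]add0n ltn_add2r sr subn_gt0.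
  rewrite /Y mulmx_sumr; apply: inradn_sum => s; rewrite mem_words => /eqP ss.
  rewrite [y s](le_decomp lP) 2!mulmx_sumr; apply: inradn_sum => k' _.
  rewrite !mulmxA (pact_le lP); case: ifP => _.
    by rewrite -mulmxA; have := inradn_pact s (le P k' *m y s); rewrite ss.
  by rewrite mul0mx; apply: inradn_0.
have [v ev] := X L (leqnn L) => {X}.
move=> k s ss ws es.
(* This correction makes the lifted relation hold exactly in [P] without changing the images under
   [p]. *)
have := fP j (fun s => y s - i *m v s) pj _ k s ss ws es.
have -> : le M k *m x s = p *m (le P k *m (y s - i *m v s)).
  by rewrite mulmxA (proj1 hp) -mulmxA mulmxBr (mulmxA p) pi0 mul0mx subr0 py.
move=> H; apply: (inrad_hom hp); apply: H.
under eq_bigr => q _ do rewrite mulmxBr mulmxA -(hom_pact _ hi) -mulmxA.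
rewrite sumrB -mulmx_sumr -ev mulmxBr -/Y (mulmxA _ i) -(proj1 hi) -mulmxA.
by rewrite eju eu subrr.
Qed.

Lemma top_free_retract M F i r : is_hom M F i -> is_hom F M r -> r *m i = 1%:M ->
  top_free F -> top_free M.
Proof.
move=> hi hr ri fF j x pj x0 k s ss ws es.
rewrite -[X in inrad X]mul1mx -ri -mulmxA; apply: (inrad_hom hr).
rewrite mulmxA (proj1 hi) -mulmxA.
apply: (fF j (fun s => i *m x s) pj _ k s) => //.
under eq_bigr => q _ do rewrite mulmxA -(hom_pact _ hi) -mulmxA.
by rewrite -mulmx_sumr mulmxA -(proj1 hi) -mulmxA x0 mulmx0.
Qed.

(** A relation at a precyclic vertex of [B] lifts to an exact one in [M], because the kernel of [q]
    vanishes there. *)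
Lemma top_free_eps_quotient M B q : is_lmod M -> is_hom M B q -> surj q ->
  (forall j (z : vec M), precyclic j -> q *m z = 0 -> le M j *m z = 0) ->
  top_free M -> top_free B.
Proof.
move=> lM hq sq ker fM j x pj x0 k s ss ws es.
have [t qt] := surj_rinv sq.
have -> : x s = q *m (t *m x s) by rewrite mulmxA qt mul1mx.
rewrite mulmxA -(proj1 hq) -mulmxA; apply: (inrad_hom hq).
apply: (fM j (fun s => t *m x s) pj _ k s) => //.
set z := \sum_(s <- words Ar L) _.
have -> : le M j *m z = le M j *m (le M j *m z) by rewrite mulmxA (le_mul lM) eqxx.
apply: ker => //; rewrite mulmxA (proj1 hq) -mulmxA mulmx_sumr -[RHS]x0; congr (_ *m _).
by apply: eq_bigr => p _; rewrite mulmxA (hom_pact _ hq) -mulmxA (mulmxA q) qt mul1mx.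
Qed.

End TopFree.

(** * Free modules *)

Section Free.
Variables (K : fieldType) (n : nat) (Ar : finType) (src tgt : Ar -> 'I_n) (L : nat).
Local Notation lmod := (lmod K n Ar).
Local Notation is_lmod := (@is_lmod K n Ar src tgt L).
Local Notation is_hom M N f := (@is_hom K n Ar M N f).
Local Notation vec M := 'cV[K]_(ldim M).
Local Notation projective := (@projective K n Ar src tgt L).
Local Notation top_free := (@top_free K n Ar src tgt L).
Local Notation pmod := (@pmod K n Ar src tgt L).
Local Notation pvec := (@pvec K n Ar src tgt L).

Lemma ker_submod M N f : is_hom M N f -> submod (fun z : vec M => f *m z = 0).
Proof.
move=> [fe fa]; split=> [|u v hu hv|c u hu|j u hu|a u hu]; first exact: mulmx0.
- by rewrite mulmxDr hu hv addr0.
- by rewrite -scalemxAr hu scaler0.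
- by rewrite mulmxA fe -mulmxA hu mulmx0.
- by rewrite mulmxA fa -mulmxA hu mulmx0.
Qed.

Lemma hom_sub M N f g : is_hom M N f -> is_hom M N g -> is_hom M N (f - g).
Proof.
by move=> [fe fa] [ge ga]; split=> j; rewrite mulmxBl mulmxBr ?fe ?ge ?fa ?ga.
Qed.

Lemma surj_mod_rad M N f : is_lmod N -> is_hom M N f ->
  (forall y : vec N, exists x, inrad (y - f *m x)) -> surj f.
Proof.
move=> lN [fe fa] H y.
apply: (nakayama (U := fun y => exists x, f *m x = y) lN); last first.
  by move=> z; have [x Hx] := H z; exists (f *m x) => //; exists x.
split.
- by exists 0; rewrite mulmx0.
- by move=> _ _ [u <-] [v <-]; exists (u + v); rewrite mulmxDr.
- by move=> c _ [u <-]; exists (c *: u); rewrite scalemxAr.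
- by move=> i _ [u <-]; exists (le M i *m u); rewrite !mulmxA fe.
- by move=> i _ [u <-]; exists (la M i *m u); rewrite !mulmxA fa.
Qed.

(** * Direct sums and free modules *)

Definition dsum (M N : lmod) : lmod := @LMod K n Ar (ldim M + ldim N)
  (fun j => block_mx (le M j) 0 0 (le N j)) (fun a => block_mx (la M a) 0 0 (la N a)).

Lemma dsum_inl M N : is_hom M (dsum M N) (col_mx 1%:M 0).
Proof.
by split=> j; rewrite /= mul_block_col mul_col_mx !mul0mx !mulmx0 !mulmx1 !mul1mx !addr0.
Qed.

Lemma dsum_inr M N : is_hom N (dsum M N) (col_mx 0 1%:M).
Proof.
by split=> j; rewrite /= mul_block_col mul_col_mx !mul0mx !mulmx0 !mulmx1 !mul1mx !add0r.
Qed.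

Lemma dsum_hom M N P f g : is_hom M P f -> is_hom N P g ->
  is_hom (dsum M N) P (row_mx f g).
Proof.
move=> [fe fa] [ge ga].
by split=> j; rewrite /= mul_row_block mul_mx_row !mulmx0 addr0 add0r ?fe ?fa ?ge ?ga.
Qed.

Lemma dsum_lmod M N : is_lmod M -> is_lmod N -> is_lmod (dsum M N).
Proof.
move=> lM lN; pose e := (mulmx_block, mul0mx, mulmx0, addr0, add0r).
have word s : word_act (dsum M N) s = block_mx (word_act M s) 0 0 (word_act N s).
  by elim: s => [|a s IHs] /=; rewrite ?IHs ?e // -scalar_mx_block.
split.
- rewrite /= scalar_mx_block -(le_sum lM) -(le_sum lN).
  by elim/big_rec3: _ => [|j x y z _ ->]; rewrite ?block_mx0 // add_block_mx !addr0.
- move=> i j /=; rewrite !e (le_mul lM) (le_mul lN); case: eqP => // _.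
  exact: block_mx0.
- move=> a /=; rewrite !e !(le_la lM, le_la lN, la_le lM, la_le lN) eqxx.
  by rewrite (la_le lM) (la_le lN) eqxx.
- move=> s hs; rewrite word -(revK s) !word_act_rev !(pact_big _ lM) ?(pact_big _ lN);
    rewrite ?size_rev ?hs //.
  exact: block_mx0.
Qed.

(** [F] plays the role of $\bigoplus_k\Lambda e_{v(k)}$, the columns of [G] being the free
    generators. Uniqueness of the induced map follows from generation modulo $J$ by Nakayama. *)
Definition isfree m (v : 'I_m -> 'I_n) (F : lmod) (G : 'M[K]_(ldim F, m)) :=
  [/\ is_lmod F, forall k, le F (v k) *m col k G = col k G,
      forall z : vec F, exists c, inrad (z - G *m c)
    & forall (N : lmod) (x : 'M[K]_(ldim N, m)), is_lmod N ->
      (forall k, le N (v k) *m col k x = col k x) ->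
      exists2 phi : 'M_(ldim N, ldim F), is_hom F N phi & phi *m G = x].

Lemma pmod_free i :
  @isfree 1 (fun=> i) (pmod xpredT i) (pvec xpredT i [::]).
Proof.
have col1 d (x : 'cV[K]_d) k : col k x = x by apply/matrixP => r c; rewrite mxE !ord1.
split=> [|k|z|N x lN ex]; first exact: pmod_lmod.
- by rewrite col1 le_pvec ?eqxx.
- have [c Hc] := pvec_nil_coord (S := xpredT) (i := i) (fun _ _ => isT) z.
  by exists c%:M; rewrite mul_mx_scalar.
have [|f hf fs] := @pfree_hom K n Ar src tgt L i N x lN.
  by have := ex 0; rewrite col1.
by exists f; rewrite // fs mul1mx.
Qed.

Lemma free_exists m (v : 'I_m -> 'I_n) : exists F G, @isfree m v F G.
Proof.
elim: m v => [|m IHm] v.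
  exists (@LMod K n Ar 0 (fun _ => 0) (fun _ => 0)), 0; split.
  - by split=> *; rewrite [LHS]flatmx0 [RHS]flatmx0.
  - by case.
  - by move=> z; exists 0; rewrite [z]flatmx0 mulmx0 subrr; apply: inrad_0.
  - move=> N x lN _; exists 0; first by split=> *; rewrite !(mulmx0, mul0mx).
    by rewrite mulmx0 [x]thinmx0.
have [F [G [lF eG gG uG]]] := IHm (fun k => v (rshift 1 k)).
set i := v (lshift m (ord0 : 'I_1)); pose P := pmod xpredT i.
have lP : is_lmod P by apply: pmod_lmod.
have ei : le P i *m pvec xpredT i [::] = pvec xpredT i [::] by rewrite le_pvec ?eqxx.
pose G' : 'M_(ldim P + ldim F, 1 + m) :=
  row_mx (col_mx (pvec xpredT i [::]) 0) (col_mx 0 G).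
exists (dsum P F), G'; split.
- exact: dsum_lmod.
- move=> k; case: (split_ordP (k : 'I_(1 + m))) => k' ->.
    have -> : col (lshift m k') G' = col_mx (pvec xpredT i [::]) 0.
      by rewrite /G' colKl; apply/matrixP => r c; rewrite mxE !ord1.
    by rewrite (ord1 k') /= mul_block_col !mul0mx mulmx0 !addr0 ei.
  have -> : col (rshift 1 k') G' = col_mx 0 (col k' G).
    rewrite /G' colKr; apply/matrixP => r c; rewrite !mxE.
    by case: splitP => ? _; rewrite !mxE.
  by rewrite /= mul_block_col !mul0mx mulmx0 !add0r eG.
- move=> z; rewrite -[z]vsubmxK.
  have [c1 h1] := pvec_nil_coord (S := xpredT) (i := i) (fun a _ => isT) (usubmx z).
  have [c2 h2] := gG (dsubmx z).
  pose c : 'cV_(1 + m) := col_mx c1%:M c2; exists c.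
  set z1 := _ - _ in h1; set z2 := _ - _ in h2.
  have H : inrad (M := dsum P F) (col_mx 1%:M 0 *m z1 + col_mx 0 1%:M *m z2).
    by apply: inrad_add;
      [apply: (inrad_hom (dsum_inl P F))|apply: (inrad_hom (dsum_inr P F))].
  suff E : col_mx (usubmx z) (dsubmx z) - G' *m c
      = col_mx 1%:M 0 *m z1 + col_mx 0 1%:M *m z2 by rewrite -E in H; exact: H.
  rewrite !mul_col_mx !mul0mx !mul1mx add_col_mx addr0 add0r.
  rewrite /G' /c mul_row_col !mul_col_mx !mul0mx mul_mx_scalar.
  by rewrite add_col_mx addr0 add0r opp_col_mx add_col_mx.
- move=> N x lN ex; pose y : 'M_(ldim N, 1 + m) := x.
  have [f0 hf0 f0e] :=
    @pfree_hom K n Ar src tgt L i N (col (lshift m (ord0 : 'I_1)) y) lN (ex _).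
  have [|f1 hf1 f1e] := uG N (rsubmx y) lN.
    by move=> k; rewrite col_rsubmx ex.
  exists (row_mx f0 f1); first exact: dsum_hom.
  suff E : row_mx f0 f1 *m G' = y by exact: E.
  rewrite /G' mul_mx_row !mul_row_col !mulmx0 addr0 add0r f0e f1e mul1mx.
  rewrite -[RHS](hsubmxK y); congr row_mx; apply/matrixP => r k.
  by rewrite !mxE (ord1 k).
Qed.

Lemma free_hom_eq m v F G N f g : @isfree m v F G -> is_hom F N f -> is_hom F N g ->
  f *m G = g *m G -> f = g.
Proof.
move=> [lF _ gG _] hf hg e; apply: eq_mul_cV => z; apply/eqP.
rewrite -subr_eq0 -mulmxBl; apply/eqP; move: z.
apply: (nakayama lF (ker_submod (hom_sub hf hg))) => z.
by have [c Hc] := gG z; exists (G *m c) => //; rewrite mulmxA mulmxBl e subrr mul0mx.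
Qed.

Lemma free_projective m v F G : @isfree m v F G -> projective F.
Proof.
move=> fF; have [lF eG gG uG] := fF; split=> // X Y g h lX lY hg sg hh.
have [s gs] := surj_rinv sg.
(* A linear preimage of the image of each generator, cut down to the vertex of that generator. *)
pose x := \matrix_(r, k) (le X (v k) *m (s *m (h *m col k G))) r 0.
have ex k : col k x = le X (v k) *m (s *m (h *m col k G)).
  by apply/matrixP => r c; rewrite !mxE ord1.
have [|f hf fG] := uG X x lX.
  by move=> k; rewrite ex mulmxA (le_mul lX) eqxx.
exists f; split=> //; apply: (free_hom_eq fF (hom_comp hf hg) hh).
apply/trmx_inj/row_matrixP => k; rewrite -!tr_col; congr trmx.
rewrite -mulmxA fG !colE -!mulmxA -!colE ex mulmxA (proj1 hg).
by rewrite -mulmxA (mulmxA g) gs mul1mx mulmxA -(proj1 hh) -mulmxA eG.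
Qed.

(** Modulo the radical each [x t] is a combination of generators. For a generator at [i], the map to
    $\Lambda e_i$ sending it to $e_i$ and the others to 0 turns the relation into one between
    distinct basis paths, so the coefficient of [s] vanishes. *)
Lemma free_top_free m v F G : @isfree m v F G -> top_free F.
Proof.
move=> fF; have [lF eG gG uG] := fF => j x pj x0 i s ss ws es.
have [c cP] := choice (fun t => gG (x t)).
suff c0 k : v k = i -> c s k 0 = 0.
  rewrite -(subrK (G *m c s) (x s)) mulmxDr; apply: inrad_add.
    exact: (inrad_le _ lF).
  rewrite (_ : G *m c s = \sum_k c s k 0 *: col k G); last first.
    apply/matrixP => r u; rewrite !mxE summxE; apply: eq_bigr => k _.
    by rewrite !mxE (ord1 u) mulrC.
  rewrite mulmx_sumr big1; first exact: inrad_0.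
  move=> k _; have [/c0->|ne] := eqVneq (v k) i; first by rewrite scale0r mulmx0.
  by rewrite -scalemxAr -eG mulmxA (le_mul lF) eq_sym (negbTE ne) mul0mx scaler0.
move=> vk; pose y : 'M_(ldim (pmod xpredT i), m) :=
  \matrix_(r, l) if l == k then pvec xpredT i [::] r 0 else 0.
have colk u : y *m u = u k 0 *: pvec xpredT i [::].
  apply/matrixP => r w; rewrite !mxE (bigD1 k) //= mxE eqxx.
  rewrite big1 ?addr0 ?(ord1 w) 1?mulrC //.
    by rewrite mxE.
  by move=> l /negbTE nl; rewrite mxE nl mul0r.
have lP : is_lmod (pmod xpredT i) by apply: pmod_lmod.
have [|f hf fG] := uG _ y lP.
  move=> l; rewrite colE colk !mxE; have [->|] := eqVneq l k;
    last by rewrite scale0r mulmx0.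
  by rewrite -scalemxAr vk le_pvec ?eqxx.
have : f *m (le F j *m \sum_(t <- words Ar L) pact F t *m x t)
   = le (pmod xpredT i) j *m \sum_(t <- words Ar L) c t k 0 *: pvec xpredT i t.
  rewrite mulmxA (proj1 hf) -mulmxA mulmx_sumr; congr (_ *m _).
  rewrite big_seq [RHS]big_seq; apply: eq_bigr => t; rewrite mem_words => /eqP st.
  (* A path of length [L] kills the radical part of [x t], leaving only the constants [c t]. *)
  rewrite -(subrK (G *m c t) (x t)) mulmxDr (pact_inradn (l := 1) lF) ?addn1 ?st //.
    rewrite add0r mulmxA (hom_pact _ hf) -mulmxA (mulmxA f) fG.
    by rewrite colk -scalemxAr pact_pvec.
  exact: inrad_inradn1.
rewrite x0 mulmx0 => /esym.
have hs : s \in pbasis src tgt L xpredT i by rewrite mem_pbasis ws orbT ss leqnn.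
have hc : (index s (pbasis src tgt L xpredT i) < size (pbasis src tgt L xpredT i))%N.
  by rewrite index_mem.
move=> /(congr1 (fun A : 'cV_(size (pbasis src tgt L xpredT i)) => A (Ordinal hc) 0)).
rewrite mulmx_sumr summxE mxE => S0.
rewrite -[LHS](sum_words_pred1 s (fun=> c s k 0)) -[RHS]S0 ss; apply: eq_bigr => t _.
rewrite -scalemxAr le_pvec // !mxE.
case: eqVneq => [->|ne]; first by rewrite es eqxx mxE nth_index // eqxx mulr1.
case: eqP => _; rewrite !mxE ?mulr0 //.
by rewrite nth_index // eq_sym (negbTE ne) mulr0.
Qed.

End Free.

(** * Finite projective dimension and approximations *)

Section Approx.
Variables (K : fieldType) (n : nat) (Ar : finType) (src tgt : Ar -> 'I_n) (L : nat).
Local Notation lmod := (lmod K n Ar).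
Local Notation is_lmod := (@is_lmod K n Ar src tgt L).
Local Notation is_hom M N f := (@is_hom K n Ar M N f).
Local Notation vec M := 'cV[K]_(ldim M).
Local Notation walk_from := (walk_from src tgt).
Local Notation precyclic := (precyclic src tgt).
Local Notation projective := (@projective K n Ar src tgt L).
Local Notation top_free := (@top_free K n Ar src tgt L).
Local Notation pd_le := (@pd_le K n Ar src tgt L).
Local Notation Pfin := (@Pfin K n Ar src tgt L).

(** * Projective covers *)

Lemma inrad_submx (M : lmod) (x : vec M) :
  inrad x <-> (x^T <= \sum_a (la M a)^T)%MS.
Proof.
split=> [[y ->]|/sub_sumsmxP[u e]].
  apply/sub_sumsmxP; exists (fun a => (y a)^T).
  by rewrite raddf_sum; apply: eq_bigr => a _; rewrite /= trmx_mul.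
exists (fun a => (u a)^T); apply: trmx_inj; rewrite e raddf_sum.
by apply: eq_bigr => a _; rewrite /= trmx_mul trmxK.
Qed.

(* Take, among all the vectors [le M j *m delta_mx r 0], a maximal subfamily that
   is independent modulo [J M]. *)
Lemma top_basis M : is_lmod M ->
  exists m (v : 'I_m -> 'I_n) (x : 'M[K]_(ldim M, m)),
  [/\ forall k, le M (v k) *m col k x = col k x,
      forall c : 'cV_m, inrad (x *m c) -> c = 0
    & forall z : vec M, exists c, inrad (z - x *m c)].
Proof.
(* On transposed vectors, multiplication by [C] has kernel exactly $JM$; the rows of [A] below are
   thus classes modulo $JM$. *)
move=> lM; pose C := cokermx (\sum_a (la M a)^T)%MS.
have JC (x : vec M) : inrad x <-> x^T *m C = 0.
  split=> [/inrad_submx|e]; first by rewrite submxE => /eqP.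
  by apply/inrad_submx; rewrite submxE -/C e.
pose g (k : 'I_#|{: 'I_n * 'I_(ldim M)}|) : vec M :=
  le M (enum_val k).1 *m delta_mx (enum_val k).2 0.
pose A := \matrix_k ((g k)^T *m C).
pose io := maxrankfun A.
pose x := \matrix_(r, k) g (io k) r 0.
have xC : x^T *m C = rowsub io A.
  apply/row_matrixP => k; rewrite row_mul row_rowsub rowK; congr (_ *m _).
  by apply/matrixP => r c; rewrite !mxE ord1.
exists _, (fun k => (enum_val (io k)).1), x; split.
- move=> k; have -> : col k x = g (io k) by apply/matrixP => r c; rewrite !mxE ord1.
  by rewrite mulmxA (le_mul lM) eqxx.
- move=> c /JC; rewrite trmx_mul -mulmxA xC => e; apply: trmx_inj; rewrite trmx0.
  by apply: (row_free_inj (maxrowsub_free A)); rewrite e mul0mx.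
move=> z; have : (z^T *m C <= rowsub io A)%MS.
  rewrite eq_maxrowsub [z](le_decomp lM) raddf_sum mulmx_suml.
  apply: summx_sub => j _ /=; rewrite [z]matrix_sum_delta mulmx_sumr raddf_sum mulmx_suml.
  apply: summx_sub => r _ /=; rewrite big_ord1 -scalemxAr linearZ -scalemxAl.
  apply: scalemx_sub; have := row_sub (enum_rank (j, r)) A.
  by rewrite rowK /g enum_rankK.
case/submxP => c; rewrite -xC mulmxA => e; exists c^T; apply/JC.
by rewrite linearB /= mulmxBl e trmx_mul trmxK subrr.
Qed.

(** The free module on a basis of $M/JM$ made of vectors at single vertices; independence of that
    basis forces the kernel into $JP$. *)
Lemma cover_exists M : is_lmod M -> exists P (phi : 'M_(ldim M, ldim P)),
  [/\ projective P, top_free P, is_hom P M phi, surj phi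
    & forall z : vec P, phi *m z = 0 -> inrad z].
Proof.
move=> lM; have [m [v [x [ex xinj xgen]]]] := top_basis lM.
have [P [G fP]] := @free_exists K n Ar src tgt L m v.
have [lP _ gG uG] := fP; have [phi hphi phiG] := uG M x lM ex.
exists P, phi; split=> //.
- exact: free_projective fP.
- exact: free_top_free fP.
- apply: (surj_mod_rad lM hphi) => y; have [c Hc] := xgen y.
  by exists (G *m c); rewrite mulmxA phiG.
move=> z phiz; have [c Hc] := gG z; have := inrad_hom hphi Hc.
rewrite mulmxBr phiz sub0r mulmxA phiG => /inrad_opp; rewrite opprK => /xinj c0.
by move: Hc; rewrite c0 mulmx0 subr0.
Qed.

(** A projective is a retract of its free cover. *)
Lemma projective_top_free P : projective P -> top_free P.
Proof.
move=> pP; have [lP lift] := pP; have [F [phi [pF fF hphi sphi _]]] := cover_exists lP.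
have [s [hs phis]] := lift F P phi 1%:M (proj1 pF) lP hphi sphi (hom_id P).
exact: top_free_retract hs hphi phis fF.
Qed.

Lemma Pfin_top_free M : Pfin M -> top_free M.
Proof.
move=> [_ [m]]; elim: m M / => [M|m M P Q i p lM pP lQ hi hp ii sp ex _ fQ].
  exact: projective_top_free.
exact: (top_free_quotient lM (proj1 pP) lQ hi hp ii sp ex (projective_top_free pP) fQ).
Qed.

(** The bound is strict, so no vertex satisfies it for [h = 0]: the empty path already has length
    0. *)
Definition height_lt h j := forall s, walk_from j s -> (size s < h)%N.

Lemma height_lt_src h a : height_lt h.+1 (src a) -> height_lt h (tgt a).
Proof. by move=> H s ws; apply: (H (a :: s)); rewrite /= eqxx. Qed.

(** The kernel of a cover lies in $JP$, hence is supported at targets of arrows leaving the support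
    of [P], where the height bound drops by one. *)
Lemma bounded_height_pd h M : is_lmod M ->
  (forall j, ~ height_lt h j -> le M j = 0) -> exists m, pd_le m M.
Proof.
elim: h M => [|h IHh] M lM supp.
  exists 0%N; apply: pd_le0; split=> // X Y g f lX lY _ _ _.
  have M0 : 1%:M = 0 :> 'M[K]_(ldim M).
    rewrite -(le_sum lM) big1 // => j _; apply: supp => H.
    by have := H [::] isT.
  by exists 0; split; [split=> j; rewrite mulmx0 mul0mx|rewrite -[f]mulmx1 M0 !mulmx0].
have [P [phi [pP fP hphi sphi kerJ]]] := cover_exists lM; have [lP _] := pP.
have [Q [i [lQ hi ii ex]]] := ker_exists lP hphi.
(* The cover has no larger height than [M]: the vectors without components at higher vertices form a
   submodule, and Nakayama applies to it. *)
have suppP j : ~ height_lt h.+1 j -> le P j = 0.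
  move=> hj; apply: eq_mul_cV => z; rewrite mul0mx; move: z j hj.
  apply: (nakayama lP); first split.
  - by move=> j _; rewrite mulmx0.
  - by move=> u w hu hw j hj; rewrite mulmxDr hu // hw // addr0.
  - by move=> c u hu j hj; rewrite -scalemxAr hu // scaler0.
  - move=> k u hu j hj; rewrite mulmxA (le_mul lP).
    by case: eqP => _; [exact: hu|rewrite mul0mx].
  - move=> a u hu j hj; rewrite mulmxA (le_la lP).
    case: eqP => [ej|_]; last by rewrite mul0mx.
    have <- : la P a *m le P (src a) = la P a by rewrite (la_le lP) eqxx.
    rewrite -mulmxA hu ?mulmx0 // => /height_lt_src H; apply: hj => s; rewrite ej => /H.
    exact: ltnW.
  (* The discarded components die in [M], so they lie in the kernel of the cover and thus in the
     radical. *)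
  move=> z; exists (\sum_(j | `[< height_lt h.+1 j >]) le P j *m z).
    move=> k hk; rewrite mulmx_sumr big1 // => j /asboolP hj.
    rewrite mulmxA (le_mul lP).
    by case: eqP => [e|_]; [case: hk; rewrite e|rewrite mul0mx].
  rewrite [X in X - _](le_decomp lP z).
  rewrite [X in X - _](bigID (fun j => `[< height_lt h.+1 j >])) /=.
  rewrite addrAC subrr add0r; apply: inrad_sum => j _ /asboolP hj; apply: kerJ.
  by rewrite mulmxA (proj1 hphi) (supp j hj) !mul0mx.
have [|m pdQ] := IHh Q lQ.
  move=> j hj; apply: eq_mul_cV => z; rewrite mul0mx; apply: ii.
  rewrite mulmxA (proj1 hi) -mulmxA.
  have [|y ->] := kerJ (i *m z); first by rewrite mulmxA (proj1 ex) mul0mx.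
  rewrite mulmx_sumr big1 // => a _; rewrite mulmxA (le_la lP).
  case: eqP => [ej|_]; last by rewrite mul0mx.
  have <- : la P a *m le P (src a) = la P a by rewrite (la_le lP) eqxx.
  rewrite (suppP (src a)) ?mulmx0 ?mul0mx // => /height_lt_src.
  by rewrite -ej.
by exists m.+1; exact: (pd_leS lM pP lQ hi hphi ii sphi ex pdQ).
Qed.

Lemma eps_pd M : is_lmod M -> (forall j, precyclic j -> le M j = 0) ->
  exists m, pd_le m M.
Proof.
move=> lM supp; apply: (bounded_height_pd (h := n) lM) => j hj; apply: supp.
by apply: contrapT => npj; apply: hj => s; apply: nonprecyclic_size.
Qed.

Lemma top_free_Pfin M : is_lmod M -> top_free M -> Pfin M.
Proof.
move=> lM fM; split=> //.
have [P [phi [pP _ hphi sphi kerJ]]] := cover_exists lM; have [lP _] := pP.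
have [Q [i [lQ hi ii ex]]] := ker_exists lP hphi.
have [|m pdQ] := eps_pd lQ;
  last by exists m.+1; exact: (pd_leS lM pP lQ hi hphi ii sphi ex pdQ).
move=> j pj; apply: eq_mul_cV => z; rewrite mul0mx; apply: ii.
rewrite mulmxA (proj1 hi) -mulmxA.
apply: (top_free_cover lP lM hphi) => //.
by rewrite mulmxA (proj1 ex) mul0mx.
Qed.

(* [F -> B] kills the nonprecyclic part of the kernel of [F -> M]. A module [X]
   of finite projective dimension has a cover whose kernel is nonprecyclic, so
   that lifting the cover to [F] yields a map from [X] to [B]. *)
Lemma approx_of_free F B M q psi : is_lmod F -> is_lmod B -> is_lmod M ->
  is_hom F B q -> is_hom B M psi -> surj q -> surj psi -> top_free F ->
  (forall j (z : vec F), precyclic j -> q *m z = 0 -> le F j *m z = 0) ->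
  (forall z : vec F, (forall j, precyclic j -> le F j *m z = 0) ->
     psi *m (q *m z) = 0 -> q *m z = 0) ->
  right_approx Pfin M B psi.
Proof.
move=> lF lB lM hq hpsi sq spsi fF kerq epsq.
have PB : Pfin B by apply: top_free_Pfin => //; apply: top_free_eps_quotient kerq fF.
split=> // X f PX hf; have [lX _] := PX; have fX := Pfin_top_free PX.
have [P [phi [[lP lift] _ hphi sphi kerJ]]] := cover_exists lX.
have hpq := hom_comp hq hpsi.
have [k [hk ek]] := lift F M _ _ lF lM hpq (surj_comp sq spsi) (hom_comp hphi hf).
have [|g hg eg] := hom_factor hphi sphi (hom_comp hk hq).
  move=> z phiz; rewrite -mulmxA; apply: epsq.
    move=> j pj; rewrite mulmxA -(proj1 hk) -mulmxA.
    by rewrite (top_free_cover lP lX hphi sphi kerJ fX pj phiz) mulmx0.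
  by rewrite !mulmxA ek -mulmxA phiz mulmx0.
exists g; split=> //; have [s es] := surj_rinv sphi.
by rewrite -[LHS]mulmx1 -[RHS]mulmx1 -es !mulmxA -(mulmxA psi) eg mulmxA ek.
Qed.

Lemma Pfin_contravariantly_finite : contravariantly_finite src tgt L Pfin.
Proof.
move=> M lM; have [F [phi [[lF _] fF hphi sphi _]]] := cover_exists lM.
(* The kernel of [E] is the nonprecyclic part of [F]; it is a submodule because arrows from
   nonprecyclic vertices end at nonprecyclic ones. *)
pose E := \sum_(j | `[< precyclic j >]) le F j.
have Ez (z : vec F) j : precyclic j -> E *m z = 0 -> le F j *m z = 0.
  move=> pj Ez; have : le F j *m (E *m z) = 0 by rewrite Ez mulmx0.
  rewrite mulmxA mulmx_sumr (bigD1 j) /=; last exact/asboolP.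
  rewrite (le_mul lF) eqxx big1 ?addr0 // => k /andP[_ ne].
  by rewrite (le_mul lF) eq_sym (negbTE ne).
have zE (z : vec F) : (forall j, precyclic j -> le F j *m z = 0) -> E *m z = 0.
  by move=> H; rewrite mulmx_suml big1 // => j /asboolP; apply: H.
(* Stacking [phi] and [E] gives a matrix whose kernel is $\varepsilon\ker\varphi$, with $\varphi$
   the map [phi]. *)
have [||B [q [lB hq sq kq]]] := quot_exists (D := col_mx phi E) lF.
- move=> j x; rewrite !mul_col_mx => /eqP; rewrite col_mx_eq0 => /andP[/eqP p0 /eqP E0].
  apply/eqP; rewrite col_mx_eq0; apply/andP; split; apply/eqP.
    by rewrite mulmxA (proj1 hphi) -mulmxA p0 mulmx0.
  apply: zE => k pk; rewrite mulmxA (le_mul lF); case: eqP => _; last by rewrite mul0mx.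
  exact: Ez.
- move=> a x; rewrite !mul_col_mx => /eqP; rewrite col_mx_eq0 => /andP[/eqP p0 /eqP E0].
  apply/eqP; rewrite col_mx_eq0; apply/andP; split; apply/eqP.
    by rewrite mulmxA (proj2 hphi) -mulmxA p0 mulmx0.
  apply: zE => k pk; rewrite mulmxA (le_la lF).
  case: eqP => [ek|_]; last by rewrite mul0mx.
  have <- : la F a *m le F (src a) = la F a by rewrite (la_le lF) eqxx.
  by rewrite -mulmxA Ez ?mulmx0 //; apply: precyclic_src; rewrite -ek.
have kq0 (z : vec F) : q *m z = 0 <-> phi *m z = 0 /\ E *m z = 0.
  rewrite kq mul_col_mx; split=> [/eqP|[-> ->]]; last by rewrite col_mx0.
  by rewrite col_mx_eq0 => /andP[/eqP-> /eqP->].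
have [|psi hpsi epsi] := hom_factor hq sq hphi; first by move=> z /kq0[].
exists B, psi; apply: (approx_of_free lF lB lM hq hpsi sq) => //.
- by move=> y; have [z <-] := sphi y; exists (q *m z); rewrite mulmxA epsi.
- by move=> j z pj /kq0[_]; apply: Ez.
- by move=> z H; rewrite mulmxA epsi => p0; apply/kq0; split=> //; apply: zE.
Qed.

End Approx.

(** * Approximations of the simple modules *)

Section Simple.
Variables (K : fieldType) (n : nat) (Ar : finType) (src tgt : Ar -> 'I_n) (L : nat).
Local Notation lmod := (lmod K n Ar).
Local Notation is_lmod := (@is_lmod K n Ar src tgt L).
Local Notation is_hom M N f := (@is_hom K n Ar M N f).
Local Notation vec M := 'cV[K]_(ldim M).
Local Notation precyclic := (precyclic src tgt).
Local Notation Pfin := (@Pfin K n Ar src tgt L).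
Local Notation Smod := (Smod K Ar).

Lemma Smod_lmod i : is_lmod (Smod i).
Proof.
split=> [|j k|a|[|a s] // _] /=.
- rewrite (bigD1 i) //= eqxx big1 ?addr0 // => j /negbTE->.
  exact: raddf0.
- rewrite -scalar_mxM -natrM mulnb; have [->|] := eqVneq j k; first by rewrite andbb.
  by move=> ne; case: eqP => [<-|_] /=; rewrite 1?eq_sym ?(negbTE ne) raddf0.
- by rewrite mulmx0 mul0mx.
- by rewrite mul0mx.
Qed.

Variable i : 'I_n.
Let pre j := `[< precyclic j >].
Local Notation A := (Amod K src tgt L i).
Local Notation basis := (pbasis src tgt L pre i).
Local Notation pvecA := (@pvec K n Ar src tgt L pre i).
Local Notation Aepi := (Aepi K src tgt L i).

Fact pre_src a : pre (tgt a) -> pre (src a).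
Proof. by move/asboolP => pt; apply/asboolP/precyclic_src. Qed.

Lemma Amod_lmod : is_lmod A.
Proof. exact: (pmod_lmod K L i pre_src). Qed.

Lemma Aepi_pvec s : Aepi *m pvecA s = (s == [::])%:R%:M.
Proof.
have [hs|hs] := boolP (s \in basis).
  rewrite [LHS](mul_pvec (fun r t => (t == [::])%:R) hs).
  by apply/matrixP => r c; rewrite !mxE !ord1 eqxx.
rewrite (pvec_notin _ hs) mulmx0; case: eqP => [e|_]; last by rewrite raddf0.
by rewrite e mem_pbasis in hs.
Qed.

Lemma Aepi_hom : is_hom A (Smod i) Aepi.
Proof.
split=> [j|a]; apply: (pvec_ext (S := pre)) => s _; rewrite -!mulmxA.
  rewrite (le_pvec K src tgt L pre i j) fun_if mulmx0 !Aepi_pvec /=.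
  rewrite -scalar_mxM -natrM mulnb.
  case: s => [|a s]; last by rewrite andbF raddf0 if_same.
  by rewrite /= andbT eq_sym; case: eqP => _ //; rewrite raddf0.
by rewrite (la_pvec K L i pre_src) Aepi_pvec mul0mx -size_eq0 size_rcons raddf0.
Qed.

Lemma Aepi_surj : surj Aepi.
Proof.
move=> y; exists (pvecA [::] *m y).
by rewrite mulmxA Aepi_pvec eqxx mul1mx.
Qed.

Lemma Smod_inrad (x : vec (Smod i)) : inrad x -> x = 0.
Proof. by move=> [y ->]; rewrite big1 // => a _; rewrite mul0mx. Qed.

Lemma Aepi_ker (z : vec A) : Aepi *m z = 0 -> inrad z.
Proof.
move=> ez; have [c Hc] := pvec_nil_coord pre_src z.
have := Smod_inrad (inrad_hom Aepi_hom Hc).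
rewrite mulmxBr ez -scalemxAr Aepi_pvec eqxx sub0r.
move=> /(congr1 (fun x : 'M_1 => x 0 0)); rewrite !mxE mulr1 => /eqP.
rewrite oppr_eq0 => /eqP c0.
by move: Hc; rewrite c0 scale0r subr0.
Qed.

(** Nontrivial basis paths end at precyclic vertices, so only the trivial path can remain at [j].
    The factor [Aepi] shows that this component vanishes on the kernel of [Aepi]. *)
Lemma Amod_nonprecyclic j : ~ precyclic j ->
  le A j = if i == j then pvecA [::] *m Aepi else 0.
Proof.
move=> npj; apply: (pvec_ext (S := pre)) => s; rewrite mem_pbasis => /and3P[_ + _].
rewrite [LHS](le_pvec K src tgt L pre i j).
case: eqP => [-> /= hs|nil hs]; last first.
  rewrite (_ : (walk_end tgt i s == j) = false).
    case: ifP => _; last by rewrite mul0mx.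
    by rewrite -mulmxA Aepi_pvec; move/eqP/negbTE: nil => ->; rewrite raddf0 mulmx0.
  by apply/eqP => e; apply: npj; rewrite -e; apply/asboolP.
case: eqP => _; last by rewrite mul0mx.
by rewrite -mulmxA Aepi_pvec eqxx mulmx1.
Qed.

Lemma Aepi_approx : right_approx Pfin (Smod i) A Aepi.
Proof.
pose F := pmod K src tgt L xpredT i.
have lF : is_lmod F by apply: pmod_lmod.
have eA : le A i *m pvecA [::] = pvecA [::] by rewrite (le_pvec K src tgt L pre i i) eqxx.
have [q hq qs] := pfree_hom Amod_lmod eA.
have {}qs s : q *m pvec K src tgt L xpredT i s = pvecA s.
  by rewrite qs (pact_pvec K L i pre_src).
have sq : surj q.
  move=> y; rewrite (pvec_sum (S := pre) y).
  exists (\sum_(c < size basis) y c 0 *: pvec K src tgt L xpredT i (nth [::] basis c)).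
  by rewrite mulmx_sumr; apply: eq_bigr => c _; rewrite -scalemxAr qs.
have fF := free_top_free (pmod_free K src tgt L i).
have kerq j (z : vec F) : precyclic j -> q *m z = 0 -> le F j *m z = 0.
  move=> pj qz.
  (* A linear section of [q]: every path ending at the precyclic vertex [j] survives in [A], so [q]
     can be undone on that component. *)
  pose t : 'M_(ldim F, size basis) := \matrix_(r, c)
    (pvec K src tgt L xpredT i (nth [::] basis c)) r 0.
  have tv s : s \in basis -> t *m pvecA s = pvec K src tgt L xpredT i s.
    move=> hs; rewrite (mul_pvec (fun r s => pvec K src tgt L xpredT i s r 0) hs).
    by apply/matrixP => r c; rewrite mxE ord1.
  suff -> : le F j = le F j *m t *m q by rewrite -(mulmxA _ q) qz mulmx0.
  apply: (pvec_ext (S := xpredT)) => s; rewrite mem_pbasis => /and3P[ws _ ss].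
  rewrite -!mulmxA qs; have [hs|hs] := boolP (s \in basis); first by rewrite tv.
  rewrite (pvec_notin K hs) !mulmx0; move: hs.
  rewrite mem_pbasis ws ss andbT /= negb_or => /andP[_ es].
  rewrite le_pvec //; case: eqP => // e; case/asboolP: es; by rewrite e.
apply: (approx_of_free lF Amod_lmod (Smod_lmod i) hq Aepi_hom sq Aepi_surj fF kerq).
move=> z epsz pz; rewrite (le_decomp Amod_lmod (q *m z)) big1 // => j _.
have [pj|npj] := pselect (precyclic j).
  by rewrite mulmxA -(proj1 hq) -mulmxA epsz ?mulmx0.
rewrite (Amod_nonprecyclic npj); case: eqP => _; last by rewrite mul0mx.
by rewrite -mulmxA pz mulmx0.
Qed.

(** An endomorphism compatible with [Aepi] is the identity modulo the radical, hence surjective by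
    Nakayama, hence invertible by dimension. *)
Lemma Aepi_minimal : min_right_approx Pfin (Smod i) A Aepi.
Proof.
split; first exact: Aepi_approx.
move=> g hg eg; have : surj g.
  apply: (surj_mod_rad Amod_lmod hg) => y; exists y; apply: Aepi_ker.
  by rewrite mulmxBr mulmxA eg subrr.
by case/surj_rinv => s /mulmx1_unit[].
Qed.

(* The factorisations through each other of [psi] and [Aepi] are mutually
   inverse up to automorphisms, by minimality on both sides. *)
Lemma min_approx_embeds B (psi : 'M[K]_(1, ldim B)) :
  min_right_approx Pfin (Smod i) B psi ->
  exists g, [/\ is_hom B A g, inj g, Aepi *m g = psi & surj psi].
Proof.
move=> [[PB hpsi facB] minB]; have [[PA hA facA] _] := Aepi_minimal.
have [g [hg eg]] := facA B psi PB hpsi.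
have [h [hh eh]] := facB A Aepi PA hA.
exists g; split=> //.
  have := minB (h *m g) (hom_comp hg hh); rewrite mulmxA eh => /(_ eg) u x gx.
  by rewrite -[x](mulKmx u) -mulmxA gx !mulmx0.
move=> y; have [x <-] := Aepi_surj y; exists (h *m x).
by rewrite mulmxA eh.
Qed.

(** The embedding [g] of [B] into [A] sends [v] outside the kernel of [Aepi], so the image of [V] is
    all of [A] by Nakayama; injectivity of [g] then gives all of [B]. *)
Lemma min_approx_generated B (psi : 'M[K]_(1, ldim B)) (V : vec B -> Prop) v :
  min_right_approx Pfin (Smod i) B psi -> submod V -> V v -> psi *m v <> 0 ->
  forall b, V b.
Proof.
move=> /min_approx_embeds[g [[ge ga] ig eg _]] [V0 Va Vc Ve Vl] hv nz b.
suff [w hw ew] : exists2 w, V w & g *m w = g *m b.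
  suff -> : b = w by [].
  apply/eqP; rewrite -subr_eq0; apply/eqP/ig.
  by rewrite mulmxBr ew subrr.
move: (g *m b); apply: (nakayama Amod_lmod); first split.
- by exists 0; rewrite ?mulmx0.
- by move=> _ _ [x hx <-] [y hy <-]; exists (x + y); [exact: Va|rewrite mulmxDr].
- by move=> c _ [x hx <-]; exists (c *: x); [exact: Vc|rewrite scalemxAr].
- by move=> j _ [x hx <-]; exists (le B j *m x); [exact: Ve|rewrite !mulmxA ge].
- by move=> a _ [x hx <-]; exists (la B a *m x); [exact: Vl|rewrite !mulmxA ga].
move=> z; set c := (psi *m v) 0 0.
have c0 : c != 0.
  by apply/eqP => e; apply: nz; apply/matrixP => r s; rewrite !ord1 [RHS]mxE.
(* Scaling by [d] gives [v] the same image in the one-dimensional simple module as [z]. *)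
pose d := (Aepi *m z) 0 0 / c.
exists (g *m (d *: v)); first by exists (d *: v); first exact: Vc.
apply: Aepi_ker; rewrite mulmxBr mulmxA eg -scalemxAr.
apply/matrixP => r s; rewrite !ord1 [LHS]mxE [X in _ + X]mxE [X in _ - X]mxE.
by rewrite -/c divfK // subrr mxE.
Qed.

(** Any vector outside the kernel of [psi] generates [B], so this kernel contains every proper
    submodule. *)
Lemma min_approx_local B (psi : 'M[K]_(1, ldim B)) :
  min_right_approx Pfin (Smod i) B psi -> local_mod B.
Proof.
move=> mB; have gen V := @min_approx_generated B psi V _ mB.
have [g [_ _ _ spsi]] := min_approx_embeds mB.
have hpsi : is_hom B (Smod i) psi by case: mB => -[].
have sub V : submod V -> Defs.proper_sub V -> forall v, V v -> psi *m v = 0.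
  by move=> sV [w nw] v hv; apply: contrapT => nz; apply: nw; apply: gen hv nz w.
have sU := ker_submod hpsi.
have pU : Defs.proper_sub (B := B) (fun z => psi *m z = 0).
  have [z ez] := spsi 1%:M; exists z; rewrite ez.
  move=> /(congr1 (fun x : 'M_1 => x 0 0)) /eqP.
  by rewrite !mxE oner_eq0.
exists (fun z => psi *m z = 0); split.
  by split=> // V sV pV _ v; apply: sub.
move=> V [sV pV maxV] v; split; first exact: (sub V sV pV).
by apply: (maxV (fun z => psi *m z = 0) sU pU) => x; apply: (sub V sV pV).
Qed.

(** In a decomposition, some summand contains a vector outside the kernel of [psi]; it is then all
    of [B], and the other summand is zero. *)
Lemma min_approx_indecomposable B (psi : 'M[K]_(1, ldim B)) :
  min_right_approx Pfin (Smod i) B psi -> indecomposable B.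
Proof.
move=> mB; have gen V := @min_approx_generated B psi V _ mB.
have [g [_ _ _ spsi]] := min_approx_embeds mB; have [z ez] := spsi 1%:M.
have nz : psi *m z <> 0.
  rewrite ez => /(congr1 (fun x : 'M_1 => x 0 0)) /eqP.
  by rewrite !mxE oner_eq0.
split=> [d0|U V sU sV UV disj].
  apply: nz; apply/matrixP => r c; rewrite mxE big1 ?mxE // => -[k lk].
  by exfalso; move: lk; rewrite d0.
have [u [v [hu hv euv]]] := UV z.
have [pu|pu] := pselect (psi *m u = 0).
  left => x Ux; apply: disj => //; apply: (gen _ _ sV hv) => pv.
  by apply: nz; rewrite euv mulmxDr pu pv addr0.
by right => x Vx; apply: disj => //; apply: (gen _ _ sU hu pu).
Qed.

End Simple.

Theorem theorem4p1 (K : fieldType) (n : nat) (Ar : finType)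
    (src tgt : Ar -> 'I_n) (L : nat) (hL : (1 <= L)%N) :
  @contravariantly_finite K n Ar src tgt L (Pfin src tgt L)
  /\ (forall i : 'I_n,
        surj (Aepi K src tgt L i)
        /\ min_right_approx (Pfin src tgt L) (Smod K Ar i) (Amod K src tgt L i)
             (Aepi K src tgt L i))
  /\ (forall (i : 'I_n) (B : lmod K n Ar) (psi : 'M[K]_(1, ldim B)),
        min_right_approx (Pfin src tgt L) (Smod K Ar i) B psi ->
        local_mod B /\ indecomposable B).
Proof.
split; first exact: Pfin_contravariantly_finite.
split=> [i|i B psi mB].
  by split; [exact: Aepi_surj|exact: Aepi_minimal].
by split; [exact: min_approx_local mB|exact: min_approx_indecomposable mB].
Qed.
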